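(* Let $K\ge 1$ be an integer, let $\{a_k\}_k\subseteq\mathbb{R}$, $\{b_k\}_k\subseteq\mathbb{R}$ and functions $s,t:\mathbb{R}\to\mathbb{R}$ be given. Assume that $$a_{k+1}\le\Big(1-\frac{1}{s(b_k)}\Big)a_k+\frac{1}{t(b_k)}\qquad\text{for all }k\in[K],$$ and that there is an interval $I$ such that $b_k\in I$ for all $k\in[K]$, $s(x)\ge1$ and $t(x)>0$ for all $x\in I$, and $r:=s/t$ is convex and differentiable on $I$. Let $u:=(\log r)'s=r't$ and suppose that there is a constant $\lambda>0$ such that $$(b_{k+1}-b_k)\cdot u(b_k)\ge-1+\frac1\lambda\qquad\text{for all }k\in[K-1].$$ Then, for all $k\in[K-1]$, $$a_{k+1}\le\lambda r(b_{k+1})+\Big(\frac{a_0}{r(b_0)}-\lambda\Big)^+\prod_{i=0}^{k}\Big(1-\frac{1/\lambda}{s(b_i)-1+1/\lambda}\Big)\,r(b_{k+1}).$$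
   Context: $[K]:=\{0,1,\dots,K\}$; $(x)^+:=\max\{x,0\}$. *)

(* Defs.v *)
From HB Require Import structures.
From mathcomp Require Import all_boot all_order all_algebra.
From mathcomp Require Import all_classical all_reals all_analysis.

Set Implicit Arguments.
Unset Strict Implicit.
Unset Printing Implicit Defensive.

Import Order.TTheory GRing.Theory Num.Theory.
Import numFieldNormedType.Exports.

Local Open Scope classical_set_scope.
Local Open Scope ring_scope.

(* Differentiability of a function on an interval, relative to that interval:
   the derivative is one-sided at an endpoint that belongs to the interval.
   If [I] is a single point, [derivable_on I f] holds trivially and
   [derive_on I f] has an arbitrary value there. *)
Definition derivable_on (R : realType) (I : interval R) (f : R -> R) :=
  forall x, x \in I ->
    cvg ((f y - f x) / (y - x) @[y --> within [set` I] x^']).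

Definition derive_on (R : realType) (I : interval R) (f : R -> R) (x : R) : R :=
  lim ((f y - f x) / (y - x) @[y --> within [set` I] x^']).

(* Main.v *)
Require Import Defs.
From mathcomp Require Import all_boot all_order all_algebra.
From mathcomp Require Import all_classical all_reals all_analysis.
From mathcomp Require Import lra ring.

Import Order.TTheory GRing.Theory Num.Theory.
Import numFieldNormedType.Exports.

Local Open Scope classical_set_scope.
Local Open Scope ring_scope.

(** Write r_k = r(b_k) and s_k = s(b_k). The tangent inequality for the convex
    function r at b_k, with r' = r (log r)', and the hypothesis on the steps of b
    give r_k (s_k - 1 + 1/lambda) <= s_k r_(k+1). Since 1/t = r/s, this bound
    makes the recursion homogeneous:
    a_(k+1) - lambda r_(k+1) <= (1 - 1/s_k) (a_k - lambda r_k). It also gives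
    (1 - 1/s_k) r_k <= (1 - (1/lambda) / (s_k - 1 + 1/lambda)) r_(k+1), so the
    bound a_k - lambda r_k <= C r_k picks up one factor of the product at each
    step. *)

Lemma segment_in_itv (R : realType) (I : interval R) (x y e : R) :
  x \in I -> y \in I -> 0 <= e <= 1 -> x + e * (y - x) \in I.
Proof.
move=> xI yI /andP[e0 e1].
have [xy|/ltW yx] := leP x y.
  by apply: (interval_is_interval xI yI); nra.
by apply: (interval_is_interval yI xI); nra.
Qed.

(** For 0 < e <= 1 the point x + e (y - x) lies in [I] and differs from x, so limits relative to [I]
    can be taken along the segment, where convexity applies. *)
Lemma cvg_segment (R : realType) (I : interval R) (x y : R) :
  x \in I -> y \in I -> x != y ->
  x + e * (y - x) @[e --> 0^'+] --> within [set` I] x^'.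
Proof.
move=> xI yI xy P.
rewrite /within /= => xP.
have cont : x + e * (y - x) @[e --> 0^'+] --> x.
  apply: cvg_at_right_filter.
  rewrite -[X in _ --> X]addr0 -[X in _ --> _ + X](mul0r (y - x)).
  by apply: cvgD; [exact: cvg_cst | apply: cvgM; [exact: cvg_id | exact: cvg_cst]].
have := cont _ xP.
rewrite /nbhs /= => near_x.
near=> e.
have e0 : 0 < e by [].
have e1 : e <= 1 by near: e; apply: nbhs_right_le.
suff : [set` I] (x + e * (y - x)) -> P (x + e * (y - x)).
  by apply; apply: segment_in_itv => //; rewrite (ltW e0).
suff : x + e * (y - x) != x ->
    [set` I] (x + e * (y - x)) -> P (x + e * (y - x)).
  apply; rewrite -subr_eq0 addrAC subrr add0r mulf_neq0 ?(gt_eqF e0)//.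
  by rewrite subr_eq0 eq_sym.
by near: e; exact: near_x.
Unshelve. all: by end_near.
Qed.

Lemma convex_segment_le (R : realType) (I : interval R) (f : R -> R) (x y e : R) :
  convex_function [set` I] f -> x \in I -> y \in I -> 0 <= e <= 1 ->
  f (x + e * (y - x)) - f x <= e * (f y - f x).
Proof.
move=> fconv xI yI e01.
have e01' : Itv.spec (@Itv.num_sem R) (Itv.Real `[0, 1]%Z) e.
  by rewrite /= /Itv.num_sem /= in_itv /= e01 ger0_real//; case/andP: e01.
(* The weight e goes to the first point, hence y before x. *)
have := fconv (Itv.mk e01') y x.
rewrite !inE => /(_ yI xI).
rewrite convRE /= /conv /= /isConvexSpace.conv /=.
rewrite /unstable.onem.
have -> : (e *: y + (1 - e) *: x : R) = x + e * (y - x).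
  by rewrite /GRing.scale /=; ring.
by lra.
Qed.

(** Chain rule in Caratheodory's form: ln z - ln (f x) = g z (z - f x) with [g] continuous at f x.
    This avoids dividing by f y - f x, which may vanish. *)
Lemma cvg_ln_slope (R : realType) (I : interval R) (f : R -> R) (x L : R) :
  0 < f x ->
  (f y - f x) / (y - x) @[y --> within [set` I] x^'] --> L ->
  (ln (f y) - ln (f x)) / (y - x) @[y --> within [set` I] x^'] --> L / f x.
Proof.
move=> fx0 fL.
have [g [gE gC gx]] := (is_derive1_caratheodory _ _ _).1 (is_derive1_ln fx0).
have idx : y @[y --> within [set` I] x^'] --> x.
  by apply: cvg_within_filter => //; exact: nbhs_dnbhs.
have fC : f y @[y --> within [set` I] x^'] --> f x.
  have : f x + (f y - f x) / (y - x) * (y - x) @[y --> within [set` I] x^']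
      --> f x + L * (x - x).
    apply: cvgD; first exact: cvg_cst.
    by apply: cvgM => //; apply: cvgB => //; exact: cvg_cst.
  rewrite subrr mulr0 addr0; apply: cvg_trans.
  apply: near_eq_cvg.
  rewrite near_withinE; near=> y => _.
  rewrite divfK; first by rewrite addrC subrK.
  by rewrite subr_eq0; near: y; exact: nbhs_dnbhs_neq.
have -> : (fun y => (ln (f y) - ln (f x)) / (y - x)) =
    (fun y => (f y - f x) / (y - x) * g (f y)).
  by apply/funext => y; rewrite gE -mulrA mulrC.
rewrite -gx; apply: cvgM => //.
exact: (cvg_comp _ _ fC gC).
Unshelve. all: by end_near.
Qed.

(** As f (log f)' = f', the left side is the tangent at x. By convexity, each difference quotient
    along the segment, times y - x, is at most f y - f x; let e tend to 0. *)
Lemma convex_ge_log_tangent (R : realType) (I : interval R) (f : R -> R) (x y : R) :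
  convex_function [set` I] f -> derivable_on I f -> x \in I -> y \in I ->
  0 < f x ->
  f x * (1 + (y - x) * derive_on I (fun z => ln (f z)) x) <= f y.
Proof.
move=> fconv fder xI yI fx0.
(* For x = y the derivative is multiplied by 0, so its arbitrary value on a one-point [I] does no
   harm. *)
have [<-|xy] := eqVneq x y; first by rewrite subrr mul0r addr0 mulr1.
have fL := fder x xI.
set L := lim _ in fL.
have lnfL := cvg_ln_slope _ _ _ _ _ fx0 fL.
have seg := cvg_segment _ _ _ _ xI yI xy.
(* [cvg_lim] would need the filter [within [set` I] x^'] to be proper; uniqueness
   of limits along the segment from x to y avoids this. *)
have -> : derive_on I (fun z => ln (f z)) x = L / f x.
  apply: (cvg_unique _ (cvg_comp _ _ seg _) (cvg_comp _ _ seg lnfL)) => //.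
  by apply/cvg_ex; exists (L / f x).
have slope : (y - x) * ((f (x + e * (y - x)) - f x) / (x + e * (y - x) - x))
    @[e --> 0^'+] --> (y - x) * L.
  by apply: cvgM; [exact: cvg_cst | exact: (cvg_comp _ _ seg fL)].
have : (y - x) * L <= f y - f x.
  apply: (cvgr_to_le slope); near=> e.
  have e0 : 0 < e by [].
  have e1 : e <= 1 by near: e; apply: nbhs_right_le.
  have yx0 : y - x != 0 by rewrite subr_eq0 eq_sym.
  rewrite [x + _ - x]addrAC subrr add0r.
  have -> : (y - x) * ((f (x + e * (y - x)) - f x) / (e * (y - x))) =
      (f (x + e * (y - x)) - f x) / e.
    by field; rewrite yx0 gt_eqF.
  rewrite ler_pdivrMr// [leRHS]mulrC.
  by apply: convex_segment_le => //; rewrite (ltW e0).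
have -> : f x * (1 + (y - x) * (L / f x)) = f x + (y - x) * L.
  by field; rewrite gt_eqF.
by lra.
Unshelve. all: by end_near.
Qed.

(** [S], [T], [r'] stand for s_k, t_k, r_(k+1), and [C] for the positive part times the product of
    the earlier factors. *)
Lemma recursion_step (R : realType) (A A' S T r' lambda C : R) :
  1 <= S -> 0 < T -> 0 < lambda -> 0 <= C ->
  A' <= (1 - 1 / S) * A + 1 / T ->
  S / T * (1 + (-1 + 1 / lambda) / S) <= r' ->
  A <= lambda * (S / T) + C * (S / T) ->
  A' <= lambda * r' + C * (1 - (1 / lambda) / (S - 1 + 1 / lambda)) * r'.
Proof.
move=> S1 T0 l0 C0 AA' rr' AC.
have S0 : 0 < S by lra.
set v := 1 / lambda in rr' *.
have v0 : 0 < v by rewrite divr_gt0.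
have lv : lambda * v = 1 by rewrite /v mulrC divfK// gt_eqF.
have d0 : 0 < S - 1 + v by lra.
have rT : (S - 1 + v) / T <= r'.
  apply: le_trans rr'; rewrite le_eqVlt; apply/orP; left; apply/eqP.
  by field; rewrite !gt_eqF.
have -> : 1 - v / (S - 1 + v) = (S - 1) / (S - 1 + v).
  by field; rewrite gt_eqF.
have w0 : 0 <= 1 - 1 / S by rewrite subr_ge0 ler_pdivrMr// mul1r.
have := ler_wpM2l w0 AC => hA.
(* The term 1 / T is absorbed through lambda v = 1: lambda (S - 1) / T + 1 / T = lambda (S - 1 + v)
   / T. *)
have e1 : (1 - 1 / S) * (lambda * (S / T) + C * (S / T)) + 1 / T =
    lambda * ((S - 1 + v) / T) + C * ((S - 1) / T).
  have -> : lambda * ((S - 1 + v) / T) = lambda * (S - 1) / T + lambda * v / T.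
    by field; rewrite gt_eqF.
  rewrite lv.
  by field; rewrite !gt_eqF.
have h1 : lambda * ((S - 1 + v) / T) <= lambda * r' by rewrite ler_pM2l.
have h2 : C * ((S - 1) / T) <= C * ((S - 1) / (S - 1 + v)) * r'.
  rewrite -mulrA; apply: ler_wpM2l => //.
  have -> : (S - 1) / T = (S - 1) / (S - 1 + v) * ((S - 1 + v) / T).
    by field; rewrite !gt_eqF.
  by apply: ler_wpM2l => //; rewrite divr_ge0//; lra.
by lra.
Qed.

Theorem corollary2p6 (R : realType) (K : nat) (a b : nat -> R) (s t : R -> R)
    (I : interval R) (lambda : R) :
  let r := fun x => s x / t x in
  let u := fun x => derive_on I (fun y => ln (r y)) x * s x in
  (1 <= K)%N ->
  (forall k, (k <= K)%N ->
     a k.+1 <= (1 - 1 / s (b k)) * a k + 1 / t (b k)) ->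
  (forall k, (k <= K)%N -> b k \in I) ->
  (forall x, x \in I -> 1 <= s x /\ 0 < t x) ->
  convex_function [set` I] r ->
  derivable_on I r ->
  0 < lambda ->
  (forall k, (k <= K - 1)%N ->
     (b k.+1 - b k) * u (b k) >= -1 + 1 / lambda) ->
  forall k, (k <= K - 1)%N ->
    a k.+1 <= lambda * r (b k.+1)
      + Num.max (a 0%N / r (b 0%N) - lambda) 0
        * (\prod_(0 <= i < k.+1)
             (1 - (1 / lambda) / (s (b i) - 1 + 1 / lambda)))
        * r (b k.+1).
Proof.
move=> r u K1 arec bI st rconv rder l0 hu k.
set M := Num.max _ _.
have M0 : 0 <= M by rewrite le_max lexx orbT.
have r0 x : x \in I -> 0 < r x.
  by move=> /st[s1 t0]; rewrite divr_gt0// (lt_le_trans ltr01).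
(* Needed for [0 <= C] in [recursion_step]; each factor is nonnegative because s >= 1. *)
have P0 n : (n <= K)%N ->
    0 <= \prod_(0 <= i < n) (1 - (1 / lambda) / (s (b i) - 1 + 1 / lambda)).
  move=> nK; rewrite big_nat; apply: prodr_ge0 => i /andP[_ ilt].
  have [s1 _] := st _ (bI i (leq_trans (ltnW ilt) nK)).
  have v0 : 0 < 1 / lambda by rewrite divr_gt0.
  by rewrite subr_ge0 ler_pdivrMr; lra.
have lt_K n : (n <= K - 1)%N -> (n < K)%N.
  by move=> nK; rewrite -(subnK K1) addn1 ltnS.
(* The invariant at n has the product over i < n, so the induction can start from a_0 with an empty
   product. *)
suff step n : (n <= K - 1)%N ->
    a n <= lambda * r (b n) + M *
      (\prod_(0 <= i < n) (1 - (1 / lambda) / (s (b i) - 1 + 1 / lambda))) *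
      r (b n) ->
    a n.+1 <= lambda * r (b n.+1) + M *
      (\prod_(0 <= i < n.+1) (1 - (1 / lambda) / (s (b i) - 1 + 1 / lambda))) *
      r (b n.+1).
  elim: k => [|k IHk] kK; apply: step => //; last exact: IHk (ltnW kK).
  (* At n = 0 the bound amounts to a_0 / r_0 - lambda <= M. *)
  rewrite big_geq// mulr1 -mulrDl -ler_pdivrMr ?r0 ?bI//.
  by rewrite -lerBlDl le_max lexx.
move=> nK an; have nK' := lt_K _ nK.
have [s1 t0] := st _ (bI _ (ltnW nK')).
have s0 : 0 < s (b n) by lra.
rewrite big_nat_recr//= [M * (_ * _)]mulrA.
apply: recursion_step an => //; first exact: mulr_ge0 M0 (P0 _ (ltnW nK')).
  exact: arec (ltnW nK').
(* Since u = (log r)' s, dividing [hu] by s_n bounds the logarithmic derivative term from below. *)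
apply: le_trans (convex_ge_log_tangent _ _ _ _ _ rconv rder
  (bI _ (ltnW nK')) (bI _ nK') (r0 _ (bI _ (ltnW nK')))).
rewrite ler_pM2l ?r0 ?bI ?(ltnW nK')// lerD2l ler_pdivrMr// -mulrA.
exact: hu.
Qed.
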